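(* Let $X$ be a (Hausdorff) topological space such that the product $X\times(\tau+1)$ is normal for some infinite cardinal $\tau$, where $\tau+1$ is equipped with the order topology. Then $X$ is $\tau$-paracompact.
   Context: All topological spaces are assumed Hausdorff. A cardinal $\tau$ is identified with an initial ordinal, and $\tau+1$ is the ordinal successor of $\tau$, regarded as an ordinal space with the usual order topology. A space $X$ is $\tau$-paracompact if each open cover of $X$ of cardinality $\leq\tau$ has a locally finite open refinement (covering $X$). *)

(* Defs.v *)
From HB Require Import structures.
From mathcomp Require Import all_boot all_order.
From mathcomp Require Import wochoice all_classical topology.
Set Implicit Arguments.
Unset Strict Implicit.
Unset Printing Implicit Defensive.
Import Order.TTheory.
Local Open Scope classical_set_scope.

(* An ordinal is represented, up to order isomorphism, by a well-ordered type;
   the elements smaller than [a], i.e. `]-oo, a[, are then the ordinal [a].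
   A cardinal is an initial ordinal: an ordinal that is not equipotent to any
   smaller ordinal. *)
Definition initial_ordinal (d : Order.disp_t) (T : orderType d) : Prop :=
  well_order (<=%O : rel T) /\
  forall a : T, ~ ([set: T] #= [set b : T | (b < a)%O])%card.

Definition infinite_cardinal (d : Order.disp_t) (T : orderType d) : Prop :=
  initial_ordinal T /\ infinite_set [set: T].

(* The ordinal successor of [T]: [Some a] stands for [a], and [None] is a new
   greatest element. *)
Definition osucc (T : Type) : Type := option T.

Section OrdinalSuccessor.
Context {d : Order.disp_t} {T : orderType d}.

HB.instance Definition _ := Choice.on (osucc T).

Definition osucc_le (x y : osucc T) : bool :=
  match x, y with
  | _, None => true
  | None, Some _ => false
  | Some a, Some b => (a <= b)%O
  end.

Fact osucc_le_refl : reflexive osucc_le.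
Proof. by case=> [a|] /=. Qed.

Fact osucc_le_anti : antisymmetric osucc_le.
Proof. by case=> [a|] [b|] //= /le_anti ->. Qed.

Fact osucc_le_trans : transitive osucc_le.
Proof. by case=> [b|] [a|] [c|] //=; apply: le_trans. Qed.

Fact osucc_le_total : total osucc_le.
Proof. by case=> [a|] [b|] //=; apply: le_total. Qed.

HB.instance Definition _ :=
  Order.Le_isPOrder.Build d (osucc T)
    osucc_le_refl osucc_le_anti osucc_le_trans.

HB.instance Definition _ :=
  Order.POrder_isTotal.Build d (osucc T) osucc_le_total.

End OrdinalSuccessor.

Section Paracompactness.
Context {X : topologicalType}.
Implicit Types U V : set (set X).

Definition open_cover U : Prop :=
  (forall A, U A -> open A) /\ cover U id = [set: X].

Definition refines V U : Prop :=
  forall B, V B -> exists2 A, U A & B `<=` A.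

Definition locally_finite V : Prop :=
  forall x : X, exists2 N, nbhs x N &
    finite_set [set B | V B /\ B `&` N !=set0].

End Paracompactness.

(* [T] only serves to specify a cardinality. *)
Definition tau_paracompact (T : Type) (X : topologicalType) : Prop :=
  forall U : set (set X), open_cover U -> (U #<= [set: T])%card ->
    exists V : set (set X),
      [/\ open_cover V, refines V U & locally_finite V].

(* Main.v *)
Require Import Defs.
From mathcomp Require Import all_boot all_order.
From mathcomp Require Import wochoice all_classical topology.
From mathcomp Require Import interval urysohn.

(** The proof shows by induction on an ordinal [g <= tau] that every family of
    open sets [U b], [b < g], has a locally finite family of open sets
    [W b `<=` U b] still covering any prescribed closed subset [F] of the union
    ([normal_product_refinable]).  Keeping the index set and covering only a
    closed set is what makes the induction hypothesis directly reusable.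

    If [g] has an immediate predecessor [a], the set [U a] is put back after the
    induction hypothesis has taken care of [F `\` U a].

    If [g] is a limit, one may assume that the [U b] cover [X].  The unions
    [V a] of the [U b] with [b < a] increase with [a], so that
    [{(x, a) | x \notin V a}] is closed in the product; as the [V a] with
    [a < g] cover [X], it misses the closed set [X * {g}].  Normality separates
    the two sets not only by open sets but by an entourage of a uniformity
    coarser than the product topology.  Comparing the points [(x, a)] and
    [(y, a)] uniformly in [a <= g] transports this entourage, and its iterated
    square roots, to [X]; compactness of the initial segment up to [g] makes the
    transported balls neighbourhoods.  In this way the [V a], [a < g], form a
    uniform cover of [X] ([limit_uniform_cover]).

    Such a cover is open for a coarser pseudometrizable topology on [X], and
    pseudometrizable spaces are paracompact (A. H. Stone); M. E. Rudin's short
    proof of this works with the sequence of entourages alone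
    ([stone_refinement]).  This yields a locally finite open cover [W a] with
    the closure of [W a] inside [V a].  By induction that closure is covered by
    a locally finite refinement [G a] of the [U b] with [b < a], and the sets
    [W a `&` G a b], gathered over [a], are the required refinement. *)

Set Implicit Arguments.
Unset Strict Implicit.
Unset Printing Implicit Defensive.
Import Order.TTheory.
Local Open Scope classical_set_scope.

(** * Well-ordered types *)

(** The classical minimum principle for [Prop]-valued subsets; [well_order] is
    about boolean predicates. *)
Definition well_ordered (d : Order.disp_t) (T : orderType d) : Prop :=
  forall P : set T, P !=set0 -> exists2 a, P a & forall b, P b -> (a <= b)%O.

Lemma well_ordered_ind (d : Order.disp_t) (T : orderType d) (P : T -> Prop) :
    well_ordered T ->
    (forall a, (forall b, (b < a)%O -> P b) -> P a) ->
  forall a, P a.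
Proof.
move=> woT IH a; apply: contrapT => nPa.
have [|b nPb bmin] := woT [set b | ~ P b]; first by exists a.
apply: nPb; apply: IH => c cb; apply: contrapT => /bmin.
by rewrite leNgt cb.
Qed.

Lemma well_order_well_ordered (d : Order.disp_t) (T : orderType d) :
  well_order (<=%O : rel T) -> well_ordered T.
Proof.
move=> woT P [a Pa].
have [|b [[Pb bmin] _]] := woT (fun x => `[< P x >]).
  by exists a; apply/asboolP.
exists b; first exact/asboolP.
by move=> c Pc; apply: bmin; apply/asboolP.
Qed.

Lemma well_ordered_osucc (d : Order.disp_t) (T : orderType d) :
  well_ordered T -> well_ordered (osucc T).
Proof.
move=> woT P P0; have [[a Pa]|nP] := pselect (exists a, P (Some a)).
  have [|b Pb bmin] := woT [set a | P (Some a)]; first by exists a.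
  by exists (Some b) => // -[c|//] /bmin.
case: P0 => -[a|] Pa; first by case: nP; exists a.
by exists None => // -[b|//] Pb; case: nP; exists b.
Qed.

Definition locally_finite_family (X : topologicalType) (I : Type)
    (W : I -> set X) : Prop :=
  forall x : X, exists2 N, nbhs x N & finite_set [set i | W i `&` N !=set0].

Lemma locally_finite_family0 (X : topologicalType) (I : Type) :
  locally_finite_family (fun _ : I => @set0 X).
Proof.
move=> x; exists setT; first exact: filterT.
by apply: (@sub_finite_set _ _ set0) => // i [y []].
Qed.

(** * Normal sequences of entourages *)

(** These are the basic entourages of a pseudometrizable uniformity whose topology
    is coarser than that of [X]: [E n x] stands for a ball of radius [2^-n]
    centred at [x].  Reflexivity comes from the last clause. *)
Definition normal_sequence (X : topologicalType) (E : nat -> X -> set X) :=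
  [/\ forall n x y, E n x y -> E n y x,
      forall n x y z, E n.+1 x y -> E n.+1 y z -> E n x z &
      forall n x, nbhs x (E n x)].

Section NormalSequence.
Context {X : topologicalType} {E : nat -> X -> set X}.
Hypothesis nsE : normal_sequence E.

Let Esym n x y : E n x y -> E n y x.
Proof. by case: nsE => + _ _; apply. Qed.

Let Etrans n y x z : E n.+1 x y -> E n.+1 y z -> E n x z.
Proof. by case: nsE => _ + _; apply. Qed.

Let Enbhs n x : nbhs x (E n x).
Proof. by case: nsE. Qed.

Let Erefl n x : E n x x.
Proof. exact: nbhs_singleton (Enbhs n x). Qed.

Let Esub m n x y : (m <= n)%N -> E n x y -> E m x y.
Proof.
elim: n => [|n IH]; first by rewrite leqn0 => /eqP ->.
rewrite leq_eqVlt => /orP[/eqP -> //|mn Exy].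
by apply: IH => //; apply: Etrans Exy (Erefl _ _).
Qed.

(** The interior for the topology of the uniformity generated by [E]. *)
Definition uinterior (S : set X) : set X := [set x | exists n, E n x `<=` S].

Lemma uinterior_sub S : uinterior S `<=` S.
Proof. by move=> x [n]; apply. Qed.

Lemma uinterior_ball S x : uinterior S x -> exists n, E n x `<=` uinterior S.
Proof.
move=> [n ES]; exists n.+1 => y xy; exists n.+1 => z yz.
exact: ES (Etrans xy yz).
Qed.

Lemma open_uinterior S : open (uinterior S).
Proof.
rewrite openE => x /uinterior_ball[n En].
exact: filterS En (Enbhs n x).
Qed.

Section Stone.
Context {d : Order.disp_t} {I : orderType d} (C : I -> set X).
Hypothesis woI : well_ordered I.
Hypothesis Copen : forall i x, C i x -> exists n, E n x `<=` C i.
Hypothesis Ccover : forall x, exists i, C i x.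

(** Rudin's construction: [D n i] below is made of the balls of radius
    [2^-(n+2)] whose centre [x] has [i] as least index of a member of the cover
    containing it, lies in no earlier [D m j], and has its ball of radius [2^-n]
    inside [C i].  The set [P] collects the earlier stages.  Balls need not be
    open, whence the uniform interior in [stage]. *)
Let centre (P : set X) n i : set X :=
  [set x | [/\ forall j, (j < i)%O -> ~ C j x, ~ P x & E n x `<=` C i]].

Let stage (P : set X) n i : set X :=
  uinterior (\bigcup_(x in centre P n i) E n.+2 x).

Let Fixpoint covered n : set X :=
  if n is m.+1 then covered m `|` \bigcup_i stage (covered m) m i else set0.

Let D n i := stage (covered n) n i.

Let D_centre n i x :
  D n i x -> exists2 y, centre (covered n) n i y & E n.+2 x y.
Proof. by move=> /uinterior_sub[y cy xy]; exists y => //; apply: Esym. Qed.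

Let D_covered m n i : (m < n)%N -> D m i `<=` covered n.
Proof.
elim: n => [//|n IH]; rewrite ltnS leq_eqVlt => /orP[/eqP <-|mn] x Dx /=.
  by right; exists i.
by left; apply: IH.
Qed.

Let covered_D n x : covered n x -> exists m i, D m i x.
Proof. by elim: n => [//|n IH] /= [/IH//|[i _ Dx]]; exists n, i. Qed.

Let D_cover x : exists m i, D m i x.
Proof.
have [i Cix imin] := woI (Ccover x).
have [n EC] := Copen Cix.
have [/covered_D//|nx] := pselect (covered n x).
exists n, i; exists n.+2 => y xy; exists x => //; split => // j ji /imin.
by rewrite leNgt ji.
Qed.

(** A ball around [x] inside [D n i] contains no centre of a stage after [n], and
    the balls of late stages are too small to reach back to [x]. *)
Let D_far n i x : D n i x -> exists m, forall k j, (m <= k)%N ->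
  ~ (D k j `&` E m x !=set0).
Proof.
move=> Dx; have [j Ej] := uinterior_ball Dx.
exists (n + j).+1 => k b mk [p [Dp xp]].
have [y [_ ny _] py] := D_centre Dp.
apply: ny; apply: (@D_covered n _ i).
  by apply: leq_trans mk; rewrite ltnS leq_addr.
apply: Ej; apply: (@Etrans _ p); first by apply: Esub xp; rewrite ltnS leq_addl.
by apply: Esub py; rewrite !leqW// (leq_trans _ mk)// ltnS leq_addl.
Qed.

(** If [i < j], a centre for [j] avoids [C i], which contains the ball of radius
    [2^-k] around every centre for [i]; the two centres are thus too far apart
    for their smaller balls to meet a common small neighbourhood. *)
Let D_discrete k i j x :
  D k i `&` E k.+3 x !=set0 -> D k j `&` E k.+3 x !=set0 -> i = j.
Proof.
wlog ij : i j / (i <= j)%O.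
  by move=> H Di Dj; case/orP: (le_total i j) => ?; [|symmetry]; apply: H.
move=> [p [Dp xp]] [q [Dq xq]].
have [y [_ _ yC] py] := D_centre Dp.
have [z [zC _ _] qz] := D_centre Dq.
move: ij; rewrite le_eqVlt => /orP[/eqP//|ij].
case: (zC _ ij); apply: yC; apply: (@Etrans _ q).
  by apply: Etrans (Esym py) (Etrans (Esym xp) xq).
by apply: Esub qz.
Qed.

(** Near a point of [D n i], the sets of late stages are excluded by [D_far] and
    each of the finitely many other stages contributes at most one set by
    [D_discrete]. *)
Lemma stone_refinement : exists W : I -> set X,
  [/\ forall i, open (W i), forall i, W i `<=` C i,
      forall x, exists i, W i x & locally_finite_family W].
Proof.
exists (fun i => \bigcup_n D n i); split.
- by move=> i; apply: bigcup_open => n _; apply: open_uinterior.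
- move=> i x [n _ /D_centre[y [_ _ yC] xy]]; apply: yC.
  by apply: Esub (Esym xy); rewrite leqW.
- by move=> x; have [n [i Dx]] := D_cover x; exists i, n.
move=> x; have [n [i Dx]] := D_cover x.
have [m mD] := D_far Dx.
exists (E m.+3 x); first exact: Enbhs.
apply: (@sub_finite_set _ _
  (\bigcup_(k in `I_m) [set j | D k j `&` E k.+3 x !=set0])).
  move=> j [p [[k _ Dp] xp]].
  have km : (k < m)%N.
    rewrite ltnNge; apply/negP => mk; apply: (mD k j mk); exists p; split => //.
    by apply: Esub xp; rewrite !leqW.
  by exists k => //; exists p; split => //; apply: Esub xp; rewrite !ltnS ltnW.
apply: bigcup_finite; first exact: finite_II.
move=> k _ /=.
have [[j Dj]|nD] := pselect (exists j, D k j `&` E k.+3 x !=set0).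
  apply: (@sub_finite_set _ _ [set j]); last exact: finite_set1.
  by move=> l /= Dl; apply: D_discrete Dl Dj.
apply: (@sub_finite_set _ _ set0); last exact: finite_set0.
by move=> j Dj; case: nD; exists j.
Qed.

End Stone.
End NormalSequence.

(** Urysohn's lemma in uniform form: in a normal space, disjoint closed sets are
    separated by an entourage of a coarser uniformity, of which one then takes
    symmetric square roots repeatedly. *)
Lemma normal_separating_sequence (X : topologicalType) (A B : set X) :
    normal_space X -> closed A -> closed B -> A `&` B = set0 ->
  exists2 E : nat -> X -> set X, normal_sequence E &
    forall x y, A x -> B y -> ~ E 0%N x y.
Proof.
move=> nX cA cB AB0.
have [uX [E0 [entE0 sepE0 finerX]]] := normal_uniform_separator nX cA cB AB0.
pose UX : uniformType := Uniform.Pack uX.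
pose sym (S : set (UX * UX)) := (S `&` S^-1)%relation.
pose G n := iter n (fun S : set (UX * UX) => sym (split_ent S)) (sym E0).
have symG n x y : G n (x, y) -> G n (y, x) by case: n => [|n] [].
have entG n : entourage (G n).
  elim: n => [|n IH] /=; first exact: entourage_invI.
  by apply: entourage_invI; exact: entourage_split_ent.
exists (fun n x y => G n (x, y)).
  split=> [n x y|n x y z xy yz|n x].
  - exact: symG.
  - by apply: (@entourage_split UX y) => //; [case: xy|case: yz].
  - apply: finerX; apply: filterS (@nbhs_entourage UX x _ (entG n)).
    by move=> y /xsectionP.
move=> x y Ax By [Exy _]; suff: (A `*` B `&` E0) (x, y) by rewrite sepE0.
by [].
Qed.

(** * Initial segments *)

Lemma order_nbhs_left (d : Order.disp_t) (T : orderTopologicalType d) (x : T)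
    (N : set T) : nbhs x N ->
  (forall b, (b <= x)%O -> N b) \/
  exists2 a, (a < x)%O & forall b, (a < b)%O -> (b <= x)%O -> N b.
Proof.
rewrite itv_nbhsE => -[[l r] [/= io xi] iN].
have xr b : (b <= x)%O -> (BRight b <= r)%O.
  move=> bx; move: xi; rewrite itv_boundlr => /andP[_ xr].
  by apply: le_trans xr; rewrite bnd_simp.
case: l io xi iN => [[] a|[]] io xi iN.
- by move: io; rewrite /itv_open_ends; case: r {xi iN xr} => [[]|[]].
- right; exists a.
    by move: xi; rewrite itv_boundlr => /andP[+ _]; rewrite bnd_simp.
  move=> b ab bx; apply: iN => /=; rewrite itv_boundlr xr// andbT.
  by rewrite bnd_simp.
- by left=> b bx; apply: iN => /=; rewrite itv_boundlr xr.
- by move: xi; rewrite itv_boundlr => /andP[].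
Qed.

(** The tube lemma for the compact space of the [a <= g].  Well-founded induction
    replaces covering arguments: near [g] a single neighbourhood serves all
    [a] above some [c < g], and the induction hypothesis deals with the others. *)
Lemma initial_segment_tube (X : topologicalType) (d : Order.disp_t)
    (T : orderTopologicalType d) (x : X) (Q : set (X * T)) (g : T) :
    well_ordered T -> (forall a, (a <= g)%O -> nbhs (x, a) Q) ->
  nbhs x [set y | forall a, (a <= g)%O -> Q (y, a)].
Proof.
move=> woT; move: g; apply: (well_ordered_ind woT) => g IH nQ.
have [[A B] [/= xA gB] ABQ] := nQ g (lexx g).
have [lB|[c cg cB]] := order_nbhs_left gB.
  apply: filterS xA => y Ay a ag; apply: (ABQ (y, a)); split => //=.
  exact: lB.
have := IH c cg (fun a ac => nQ a (le_trans ac (ltW cg))).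
apply: filterS2 xA => y Ay yc a ag.
have [/yc //|ca] := leP a c.
by apply: (ABQ (y, a)); split => //=; apply: cB.
Qed.

Section InitialSegmentRefinement.
Context {X : topologicalType} {d : Order.disp_t} {T : orderTopologicalType d}.
Hypothesis woT : well_ordered T.
Hypothesis nXT : normal_space (X * T)%type.

Lemma segment_normal_sequence (E : nat -> X * T -> set (X * T)) (g : T) :
    normal_sequence E ->
  normal_sequence
    (fun n x => [set y | forall a, (a <= g)%O -> E n (x, a) (y, a)]).
Proof.
case=> Esym Etrans Enbhs; split=> [n x y xy a /xy|n x y z xy yz a ag|n x] /=.
- exact: Esym.
- by apply: Etrans (xy a ag) (yz a ag).
(* The centre [(x, p.2)] moves with [p], so it is compared with the fixed
   point [(x, a)] at the price of one index. *)
apply: (@initial_segment_tube _ _ _ x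
  [set p | E n (x, p.2) p] g) => // a ag.
have [[A B] [/= xA aB] AB] := Enbhs n.+1 (x, a).
exists (A, B) => //= -[y b] /= [Ay Bb].
apply: (Etrans _ _ (x, a)); last exact: (AB (y, b)).
apply: Esym; apply: (AB (x, b)); split => //=; exact: nbhs_singleton.
Qed.

Definition sub_union (U : T -> set X) (a : T) : set X :=
  [set x | exists2 b, (b < a)%O & U b x].

Definition refinable (g : T) : Prop :=
  forall (U : T -> set X) (F : set X), (forall b, open (U b)) -> closed F ->
    F `<=` sub_union U g ->
  exists W : T -> set X, [/\ forall b, open (W b), forall b, W b `<=` U b,
    F `<=` sub_union W g & locally_finite_family W].

Lemma refinable_succ g a :
  (a < g)%O -> (forall b, (b < g)%O -> (b <= a)%O) -> refinable a ->
  refinable g.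
Proof.
move=> ag amax IH U F oU cF FU.
have [||W [oW WU FW lW]] := IH U (F `\` U a) oU.
- by apply: closedI => //; rewrite closedC.
- move=> x [/FU[b bg Ubx] nUa]; exists b => //.
  by rewrite lt_neqAle amax// andbT; apply: contra_notN nUa => /eqP <-.
exists (fun b => if b == a then U a else W b); split.
- by move=> b; case: ifP.
- by move=> b; case: ifP => // /eqP ->.
- move=> x Fx; have [Uax|nUax] := pselect (U a x).
    by exists a => //; rewrite eqxx.
  have [|b ba Wbx] := FW x; first by [].
  by exists b; [exact: lt_trans ag|rewrite lt_eqF].
move=> x; have [N Nx fN] := lW x; exists N => //.
apply: (@sub_finite_set _ _ ([set a] `|` [set b | W b `&` N !=set0])).
  by move=> b /=; case: ifP => [/eqP ->|_] ?; [left|right].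
by rewrite finite_setU; split => //; exact: finite_set1.
Qed.

Lemma open_sub_union_graph (U : T -> set X) : (forall b, open (U b)) ->
  open [set p : X * T | sub_union U p.2 p.1].
Proof.
move=> oU; rewrite openE => -[x a] /= [b ba Ubx].
exists (U b, `]b, +oo[%classic) => /=.
  split; first exact: open_nbhs_nbhs.
  by apply: open_nbhs_nbhs; split; [exact: rray_open|rewrite /= in_itv/= ba].
by move=> [y c] /= [Uby]; rewrite in_itv/= andbT => bc; exists b.
Qed.

(** The entourage [E 0] on the product separates [X * {g}] from the points [(x, a)]
    with [x] outside [sub_union U a].  For fixed [x] some [(x, c)] with [c < g] is
    [E 1]-close to [(x, g)]; any [y] that is [E 1]-close to [x] uniformly in [a]
    then has [(y, c)] [E 0]-close to [(x, g)], which forces [y] into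
    [sub_union U c]. *)
Lemma limit_uniform_cover (U : T -> set X) (g : T) :
    (forall b, (b < g)%O -> exists2 c, (b < c)%O & (c < g)%O) ->
    (forall b, open (U b)) -> setT `<=` sub_union U g ->
  exists2 E : nat -> X -> set X, normal_sequence E &
    forall x, exists2 a, (a < g)%O & E 1%N x `<=` sub_union U a.
Proof.
move=> glim oU UX.
pose A := [set p : X * T | p.2 = g].
pose B := [set p : X * T | ~ sub_union U p.2 p.1].
have cA : closed A.
  apply: (@closed_comp _ _ snd [set g]) => [[y b] _|]; first exact: cvg_snd.
  by rewrite -set_itv1; exact: itv_closed.
have cB : closed B by apply: open_closedC; exact: open_sub_union_graph.
have AB0 : A `&` B = set0.
  by rewrite -subset0 => p [pg]; apply; rewrite pg; exact: UX.
have [E nsE sepE] := normal_separating_sequence nXT cA cB AB0.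
exists (fun n x => [set y | forall a, (a <= g)%O -> E n (x, a) (y, a)]).
  exact: segment_normal_sequence.
case: nsE => _ Etrans Enbhs x.
have [c cg xc] : exists2 c, (c < g)%O & E 1%N (x, g) (x, c).
  have [[V N] [/= xV gN] VN] := Enbhs 1%N (x, g).
  have xN c : N c -> E 1%N (x, g) (x, c).
    by move=> Nc; apply: VN; split => //=; exact: nbhs_singleton.
  have [lN|[b bg bN]] := order_nbhs_left gN.
    have [b bg _] := UX x I; exists b => //.
    by apply: xN; apply: lN; exact: ltW.
  have [c bc cg] := glim b bg; exists c => //.
  by apply: xN; apply: bN => //; exact: ltW.
exists c => // y xy; apply: contrapT => nVy.
apply: (sepE (x, g) (y, c)) => //.
by apply: Etrans xc _; apply: xy; exact: ltW.
Qed.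

Lemma limit_shrunk_refinement (U : T -> set X) (g : T) :
    (forall b, (b < g)%O -> exists2 c, (b < c)%O & (c < g)%O) ->
    (forall b, open (U b)) -> setT `<=` sub_union U g ->
  exists W : T -> set X, [/\ forall a, open (W a),
    forall a, W a !=set0 -> (a < g)%O,
    forall a, closure (W a) `<=` sub_union U a,
    forall x, exists a, W a x & locally_finite_family W].
Proof.
move=> glim oU UX.
have [E nsE Eg] := limit_uniform_cover glim oU UX.
have [Esym Etrans Enbhs] := nsE.
(* Points with a whole ball in [sub_union U a]: any point of the closure is
   [E 2]-close to one of them, hence in [sub_union U a]. *)
pose S a := [set x | (a < g)%O /\ E 2%N x `<=` sub_union U a].
have SC x : exists a, uinterior (E := E) (S a) x.
  have [a ag Ea] := Eg x; exists a; exists 2%N => y xy; split => // z yz.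
  by apply: Ea; apply: Etrans xy yz.
have [|W [oW WC covW lW]] := stone_refinement nsE woT _ SC.
  by move=> a x; exact: (uinterior_ball nsE).
have WS a : W a `<=` S a by move=> x /WC /(uinterior_sub nsE).
exists W; split => //; first by move=> a [x /WS[]].
move=> a z /(_ _ (Enbhs 2%N z))[w [/WS[_ Ew] zw]].
by apply: Ew; exact: Esym.
Qed.

(** The closures of the [W a] are closed sets covered by the [U b] with [b < a],
    to which the induction hypothesis applies; intersecting with the locally
    finite [W a] keeps the union of all these refinements locally finite. *)
Lemma refinable_limit g :
    (forall b, (b < g)%O -> exists2 c, (b < c)%O & (c < g)%O) ->
    (forall a, (a < g)%O -> refinable a) ->
  refinable g.
Proof.
move=> glim IH.
(* Adding the complement of [F] to each [U b] reduces to covering all of [X]. *)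
suff cover_case (U : T -> set X) : (forall b, open (U b)) ->
    setT `<=` sub_union U g ->
    exists W : T -> set X, [/\ forall b, open (W b), forall b, W b `<=` U b,
      setT `<=` sub_union W g & locally_finite_family W].
  move=> U F oU cF FU.
  have [[b bg]|g0] := pselect (exists b, (b < g)%O); last first.
    exists (fun=> set0); split => [b|b x []||] //; first exact: open0.
      by move=> x /FU[b bg _]; case: g0; exists b.
    exact: locally_finite_family0.
  have [||W [oW WU FW lW]] := cover_case (fun b => U b `|` ~` F).
  + by move=> c; apply: openU => //; rewrite openC.
  + move=> x _; have [/FU[c cg Ucx]|nFx] := pselect (F x).
      by exists c => //; left.
    by exists b => //; right.
  exists (fun c => W c `&` U c); split.
  - by move=> c; exact: openI.
  - by move=> c x [].
  - move=> x Fx; have [c cg Wcx] := FW x I.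
    by exists c => //; split => //; have [|] := WU c x Wcx.
  move=> x; have [N Nx fN] := lW x; exists N => //.
  by apply: sub_finite_set fN => c [y [[Wy _] Ny]]; exists y.
move=> oU UX.
have [W [oW Wg clW covW lW]] := limit_shrunk_refinement glim oU UX.
have /choice[G GP] : forall a, exists G : T -> set X, [/\ forall b, open (G b),
    forall b, G b `<=` U b, W a `<=` sub_union G a & locally_finite_family G].
  move=> a; have [ag|nag] := pselect (a < g)%O.
    have [G [oG GU WG lG]] := IH a ag U _ oU (@closed_closure _ _) (clW a).
    by exists G; split => // x /(@subset_closure _ (W a))/WG.
  exists (fun=> set0); split => [b|b x []||] //; first exact: open0.
    by move=> x Wx; case: nag; apply: Wg; exists x.
  exact: locally_finite_family0.
exists (fun b => \bigcup_(a in [set a | (b < a)%O]) (W a `&` G a b)); split.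
- by move=> b; apply: bigcup_open => a _; apply: openI => //; case: (GP a).
- by move=> b x [a _ [_ Gx]]; case: (GP a) => _ + _ _; apply.
- move=> x _; have [a Wax] := covW x.
  have [_ _ /(_ x Wax)[b ba Gx] _] := GP a.
  by exists b; [apply: lt_trans ba _; apply: Wg; exists x|exists a].
move=> x; have [N Nx fN] := lW x.
have /choice[M MP] : forall a, exists M, nbhs x M /\
    finite_set [set b | G a b `&` M !=set0].
  by move=> a; case: (GP a) => _ _ _ /(_ x)[M ? ?]; exists M.
pose A := [set a | W a `&` N !=set0].
exists (N `&` \bigcap_(a in A) M a).
  apply: filterI => //; have /finite_fsetP[D AD] := fN.
  rewrite /A AD.
  by apply: filter_bigI => a _; case: (MP a).
apply: (@sub_finite_set _ _ (\bigcup_(a in A) [set b | G a b `&` M a !=set0])).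
  move=> b [y [[a _ [Wy Gy]] [Ny My]]]; have Aa : A a by exists y.
  by exists a => //; exists y; split => //; exact: My.
by apply: bigcup_finite => // a _; case: (MP a).
Qed.

Lemma normal_product_refinable g : refinable g.
Proof.
move: g; apply: (well_ordered_ind woT) => g IH.
have [[a ag amax]|nmax] :=
    pselect (exists2 a, (a < g)%O & forall b, (b < g)%O -> (b <= a)%O).
  exact: refinable_succ ag amax (IH a ag).
apply: refinable_limit IH => b bg; apply: contrapT => nc; apply: nmax.
exists b => // c cg; rewrite leNgt; apply/negP => bc.
by apply: nc; exists c.
Qed.

End InitialSegmentRefinement.

Theorem theorem5p4 (X : topologicalType) (d : Order.disp_t) (tau : orderType d)
    (hX : hausdorff_space X) (htau : infinite_cardinal tau)
    (hN : normal_space (X * order_topology (osucc tau))%type) :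
  tau_paracompact tau X.
Proof.
move=> U [oU covU] /card_leP[f].
have woT : well_ordered (order_topology (osucc tau)).
  apply: well_ordered_osucc; apply: well_order_well_ordered.
  by case: htau => -[].
(* The cover is indexed by [tau] through [f]; indices that are not hit, among
   them the top one, get the empty set. *)
pose V (b : order_topology (osucc tau)) : set X :=
  \bigcup_(A in [set A : U | Some (val (f A)) = b]) val A.
have [|||W [oW WV covW lW]] :=
  @normal_product_refinable _ _ _ woT hN None V setT.
- by move=> b; apply: bigcup_open => A _; apply: oU; exact: set_valP.
- exact: closedT.
- move=> x _; have : cover U id x by rewrite covU.
  move=> [A UA Ax]; pose A' : U := SigSub (mem_set UA).
  by exists (Some (val (f A'))) => //; exists A'.
(* Empty members are dropped, since they need not lie in any member of [U]. *)
exists [set B | B !=set0 /\ range W B]; split.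
- split; first by move=> _ [_ [b _ <-]].
  rewrite -subTset => x _; have [b _ Wx] := covW x I.
  by exists (W b) => //; split; [exists x|exists b].
- move=> B [B0 [b _ eWb]]; move: B0; rewrite -eWb => -[x Wx].
  have [A fA Ax] := WV _ _ Wx; exists (val A); first exact: set_valP.
  move=> y /WV[A' fA' A'y]; suff <- : A' = A by [].
  apply: (@inj _ _ setT f); rewrite ?in_setT//; apply: val_inj.
  by move: fA; rewrite /= -fA' => -[].
move=> x; have [N Nx fN] := lW x; exists N => //.
apply: sub_finite_set (finite_image W fN) => _ [[_ [b _ <-]] WN].
by exists b.
Qed.
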